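(* Let $\mathcal C_4$ be the set of all qubit channels whose Choi state has rank four, and let $\mathcal U_4\subseteq\mathcal C_4$ be the set of those $\Lambda\in\mathcal C_4$ for which the final shared state $(\mathbf I\otimes\Lambda)(|\Phi_1\rangle\langle\Phi_1|)$, obtained by sending one half of the Bell state $|\Phi_1\rangle=\frac{1}{\sqrt2}(|00\rangle+|11\rangle)$ through $\Lambda$, is useful for universal quantum teleportation (UQT). Then $\mathcal U_4$ is a nonempty strict subset of $\mathcal C_4$.
   Context: A qubit channel is a completely positive trace-preserving linear map $\Lambda$ on $2\times2$ complex matrices. Its Choi state is $\rho_{\Lambda,\Phi_1}=(\mathbf I\otimes\Lambda)(|\Phi_1\rangle\langle\Phi_1|)$. If Alice prepares a two-qubit state $\rho$ and sends one half (the second qubit) through $\Lambda$, the final shared state is $(\mathbf I\otimes\Lambda)(\rho)$. Useful for UQT. For a two-qubit density matrix $\rho$ let $T_\rho$ be the real $3\times3$ matrix with entries $T_{ij}=\mathrm{Tr}(\rho\,\sigma_i\otimes\sigma_j)$ ($\sigma_1,\sigma_2,\sigma_3$ the Pauli matrices). By local unitaries $\rho$ can be brought to a canonical form $\rho_C$ with diagonal correlation matrix $\mathrm{diag}(\tau_1,\tau_2,\tau_3)$, $\tau_k=\lambda_k|t_{kk}|$, $\lambda_k\in\{\pm1\}$, where $|t_{11}|,|t_{22}|,|t_{33}|$ are the singular values of $T_\rho$; if $\det T_\rho\le 0$ all $\lambda_k=-1$, and if $\det T_\rho>0$ the $\lambda_k$ equal $-1$ for the two largest $|t_{kk}|$ and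 $+1$ for the smallest. The maximal average fidelity $F_\rho$ is the average teleportation fidelity (over uniformly distributed pure qubit inputs, standard teleportation protocol, maximized over local unitaries), attained by $\rho_C$, and the fidelity deviation $\Delta_\rho$ is the standard deviation over inputs of the fidelity when $\rho_C$ is used; explicitly $F_\rho=\frac12\bigl(1-\frac13\sum_k\tau_k\bigr)$ and $\Delta_\rho=\frac{1}{3\sqrt{10}}\sqrt{\sum_{i<j}(\tau_i-\tau_j)^2}$. The state $\rho$ is useful for UQT if $F_\rho>\frac23$ and $\Delta_\rho=0$; equivalently, $\det T_\rho<0$ and $|t_{11}|=|t_{22}|=|t_{33}|>\frac13$. *)

(* Defs.v *)
From HB Require Import structures.
From mathcomp Require Import all_boot all_order all_algebra.
From mathcomp Require Import complex mxtens.
From mathcomp Require Import all_classical all_reals all_analysis.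

Set Implicit Arguments.
Unset Strict Implicit.
Unset Printing Implicit Defensive.

Import Order.TTheory GRing.Theory Num.Theory.
Import numFieldNormedType.Exports.

Local Open Scope classical_set_scope.
Local Open Scope sesquilinear_scope.
Local Open Scope complex_scope.
Local Open Scope ring_scope.

Section Channels.
Variable R : realType.
Local Notation C := R[i].

Definition psdmx n (A : 'M[C]_n) : Prop :=
  A \is hermsymmx /\ forall v : 'cV[C]_n, 0 <= (v^t* *m A *m v) 0 0.

(* [idtens n L X] is (id_n (x) L)(X): L acts on each 2 x 2 block of X, the
   basis vector |i> (x) |k> having index [mxtens_index (i, k)]. *)
Definition idtens n (L : 'M[C]_2 -> 'M[C]_2) (X : 'M[C]_(n * 2)) :
    'M[C]_(n * 2) :=
  \sum_(i < n) \sum_(j < n) delta_mx i j *t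
    L (\matrix_(k, l) X (mxtens_index (i, k)) (mxtens_index (j, l))).

Definition completely_positive (L : 'M[C]_2 -> 'M[C]_2) : Prop :=
  forall n (X : 'M[C]_(n * 2)), psdmx X -> psdmx (idtens L X).

Definition trace_preserving (L : 'M[C]_2 -> 'M[C]_2) : Prop :=
  forall X : 'M[C]_2, \tr (L X) = \tr X.

Definition qubit_channel (L : {linear 'M[C]_2 -> 'M[C]_2}) : Prop :=
  completely_positive L /\ trace_preserving L.

Definition ket2 (a b : 'I_2) : 'cV[C]_(2 * 2) := delta_mx (mxtens_index (a, b)) 0.

Definition proj n (v : 'cV[C]_n) : 'M[C]_n := v *m v^t*.

Definition Phi1 : 'cV[C]_(2 * 2) :=
  ((Num.sqrt 2)^-1)%:C *: (ket2 0 0 + ket2 1 1).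

(* The shared state after Bob's half of a Bell pair goes through the channel;
   this is also the Choi state of the channel. *)
Definition choi (L : 'M[C]_2 -> 'M[C]_2) : 'M[C]_(2 * 2) :=
  @idtens 2 L (proj Phi1).

End Channels.

Section Teleportation.
Variable R : realType.
Local Notation C := R[i].

(* [pauli 0] is the identity; [pauli 1], [pauli 2], [pauli 3] are the Pauli
   matrices. *)
Definition pauli (k : 'I_4) : 'M[C]_2 := \matrix_(i, j)
  match val k with
  | 0 => (i == j)%:R
  | 1 => (i != j)%:R
  | 2 => if i == j then 0 else if i == 0 then - 'i%C else 'i%C
  | _ => if i != j then 0 else if i == 0 then 1 else -1
  end.

Definition correlation_mx (rho : 'M[C]_(2 * 2)) : 'M[R]_3 :=
  \matrix_(i, j)
    complex.Re (\tr (rho *m (pauli (lift ord0 i) *t pauli (lift ord0 j)))).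

Definition singlet : 'cV[C]_(2 * 2) :=
  ((Num.sqrt 2)^-1)%:C *: (ket2 R 0 1 - ket2 R 1 0).

(* The Bell basis, up to phases: the vectors (sigma_k (x) 1) |singlet>. *)
Definition bell (k : 'I_4) : 'cV[C]_(2 * 2) := (pauli k *t 1%:M) *m singlet.

(* Standard protocol with the singlet as reference resource, which is the one
   adapted to canonical forms having negative tau_k: the input psi and the
   shared state rho are put together, the first two qubits are measured in the
   Bell basis, and outcome k makes Bob apply sigma_k.  [tele_branch] is Bob's
   unnormalised state: its trace is the probability of outcome k. *)
Definition tele_branch (rho : 'M[C]_(2 * 2)) (psi : 'cV[C]_2) (k : 'I_4) :
    'M[C]_2 :=
  let joint : 'M[C]_(2 * 2 * 2) :=
    castmx (mulnA 2 2 2, mulnA 2 2 2) (proj psi *t rho) in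
  let bra : 'M[C]_(1 * 2, 2 * 2 * 2) := (bell k)^t* *t (1%:M : 'M[C]_2) in
  pauli k *m (bra *m joint *m bra^t* : 'M[C]_2) *m (pauli k)^t*.

Definition tele_output (rho : 'M[C]_(2 * 2)) (psi : 'cV[C]_2) : 'M[C]_2 :=
  \sum_(k < 4) tele_branch rho psi k.

Definition tele_fidelity (rho : 'M[C]_(2 * 2)) (psi : 'cV[C]_2) : R :=
  complex.Re ((psi^t* *m tele_output rho psi *m psi) 0 0).

Definition bloch_ket (theta phi : R) : 'cV[C]_2 :=
  \col_i if i == 0 then (cos (theta / 2))%:C
         else (cos phi +i* sin phi) * (sin (theta / 2))%:C.

(* Mean over the uniform distribution on pure qubit states, i.e. the
   normalised area measure of the Bloch sphere. *)
Definition uniform_mean (g : 'cV[C]_2 -> R) : R :=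
  (4 * pi)^-1 *
  \int[@lebesgue_measure R]_(theta in `[0, pi])
    \int[@lebesgue_measure R]_(phi in `[0, 2 * pi])
      (g (bloch_ket theta phi) * sin theta).

Definition mean_fidelity (rho : 'M[C]_(2 * 2)) : R :=
  uniform_mean (tele_fidelity rho).

Definition std_fidelity (rho : 'M[C]_(2 * 2)) : R :=
  Num.sqrt (uniform_mean
    (fun psi => (tele_fidelity rho psi - mean_fidelity rho) ^+ 2)).

Definition local_rotation (U V : 'M[C]_2) (rho : 'M[C]_(2 * 2)) :
    'M[C]_(2 * 2) :=
  (U *t V) *m rho *m (U *t V)^t*.

Definition max_fidelity (rho : 'M[C]_(2 * 2)) : R :=
  sup [set f | exists U V : 'M[C]_2,
    [/\ U \is unitarymx, V \is unitarymx &
        f = mean_fidelity (local_rotation U V rho)]].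

(* The singular values of T, with multiplicity, in some order. *)
Definition singular_values (T : 'M[R]_3) (s : 'I_3 -> R) : Prop :=
  (forall k, 0 <= s k) /\
  char_poly (T^T *m T) = \prod_k ('X - (s k ^+ 2)%:P).

Definition canonical_signs (T : 'M[R]_3) (s lambda : 'I_3 -> R) : Prop :=
  if \det T <= 0 then forall k, lambda k = -1
  else exists k0, [/\ forall k, s k0 <= s k, lambda k0 = 1 &
                      forall k, k != k0 -> lambda k = -1].

Definition is_canonical_form (rho rhoC : 'M[C]_(2 * 2)) : Prop :=
  exists U V : 'M[C]_2, exists s lambda : 'I_3 -> R,
    [/\ U \is unitarymx /\ V \is unitarymx,
        rhoC = local_rotation U V rho,
        singular_values (correlation_mx rho) s,
        canonical_signs (correlation_mx rho) s lambda &
        correlation_mx rhoC = diag_mx (\row_k (lambda k * s k))].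

(* Canonical forms exist but are not unique; the fidelity deviation does not
   depend on the one that is chosen. *)
Definition canonical_form (rho : 'M[C]_(2 * 2)) : 'M[C]_(2 * 2) :=
  xget rho [set rhoC | is_canonical_form rho rhoC].

Definition fidelity_deviation (rho : 'M[C]_(2 * 2)) : R :=
  std_fidelity (canonical_form rho).

Definition useful_for_UQT (rho : 'M[C]_(2 * 2)) : Prop :=
  2 / 3 < max_fidelity rho /\ fidelity_deviation rho = 0.

End Teleportation.

Definition C4 (R : realType) : set {linear 'M[R[i]]_2 -> 'M[R[i]]_2} :=
  [set L | qubit_channel L /\ \rank (choi L) = 4%N].

Definition U4 (R : realType) : set {linear 'M[R[i]]_2 -> 'M[R[i]]_2} :=
  [set L | C4 L /\ useful_for_UQT (choi L)].

(* Main.v *)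
Require Import Defs.
From HB Require Import structures.
From mathcomp Require Import all_boot all_order all_algebra.
From mathcomp Require Import complex mxtens ring lra.
From mathcomp Require Import all_classical all_reals all_analysis.

Set Implicit Arguments.
Unset Strict Implicit.
Unset Printing Implicit Defensive.

Import Order.TTheory GRing.Theory Num.Theory.
Import numFieldNormedType.Exports.

Local Open Scope classical_set_scope.
Local Open Scope sesquilinear_scope.
Local Open Scope complex_scope.
Local Open Scope ring_scope.

(* Let L_p be the channel that applies sigma_k with probability w_k, where
   w_2 = (1 + 3p)/4 and w_k = (1 - p)/4 otherwise.  Since sigma_2 sends Phi1 to
   the singlet, the Choi state of L_p is the Werner state
   p |singlet><singlet| + (1 - p)/4, which is invertible for 0 <= p < 1 and has
   correlation matrix -p.

   For an arbitrary resource rho, averaging over the four Bell outcomes leaves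
   the fidelity (tr rho - sum_i T_ii n_i^2)/2 at Bloch vector n.  Its mean is
   (tr rho - tr T / 3)/2, and it does not depend on n when T is scalar.  Hence
   L_(1/2) is useful (fidelity at least 3/4, deviation 0), whereas for p = 0 the
   state is I/4, fixed by all local unitaries, with fidelity 1/2. *)

(** * Tensor indices and finite case analysis *)

Lemma big_mxtens_index (V : nmodType) m n (F : 'I_(m * n) -> V) :
  \sum_i F i = \sum_(i < m) \sum_(j < n) F (mxtens_index (i, j)).
Proof.
rewrite pair_bigA (reindex (@mxtens_index m n)) /=.
  by apply: eq_bigr => -[].
exists (@mxtens_unindex m n) => i _;
  by rewrite (mxtens_indexK, mxtens_unindexK).
Qed.

(** This describes the [castmx] of [tele_branch], which regroups input, Alice and Bob from 1+2 to
    2+1 qubits. *)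
Lemma mxtens_indexA m n p (a : 'I_m) (b : 'I_n) (c : 'I_p) :
  cast_ord (esym (mulnA m n p)) (mxtens_index (mxtens_index (a, b), c)) =
  mxtens_index (a, mxtens_index (b, c)).
Proof. by apply: val_inj; rewrite /= mulnDl mulnA addnA. Qed.

(** Shaped as an eliminator, so that [elim/] splits a matrix identity into its entries with indices
    in the literal form [0], [1]. *)
Lemma forall_ord2 (P : 'I_2 -> Prop) : P 0 -> P 1 -> forall i, P i.
Proof.
move=> P0 P1 [[|[|//]] i_lt2].
  by have -> : Ordinal i_lt2 = 0 by apply: val_inj.
by have -> : Ordinal i_lt2 = 1 by apply: val_inj.
Qed.

Lemma forall_ord3 (P : 'I_3 -> Prop) : P 0 -> P 1 -> P 2 -> forall i, P i.
Proof.
move=> P0 P1 P2 [[|[|[|//]]] i_lt].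
- by have -> : Ordinal i_lt = 0 by apply: val_inj.
- by have -> : Ordinal i_lt = 1 by apply: val_inj.
- by have -> : Ordinal i_lt = 2 by apply: val_inj.
Qed.

Lemma forall_ord4 (P : 'I_4 -> Prop) :
  P 0 -> P 1 -> P 2 -> P 3 -> forall i, P i.
Proof.
move=> P0 P1 P2 P3 [[|[|[|[|//]]]] i_lt].
- by have -> : Ordinal i_lt = 0 by apply: val_inj.
- by have -> : Ordinal i_lt = 1 by apply: val_inj.
- by have -> : Ordinal i_lt = 2 by apply: val_inj.
- by have -> : Ordinal i_lt = 3 by apply: val_inj.
Qed.

Definition ord2E := ((eqxx (0 : 'I_2)), (eqxx (1 : 'I_2)),
  (erefl : (0 == 1 :> 'I_2) = false), (erefl : (1 == 0 :> 'I_2) = false)).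

Lemma sum_ord2 (V : nmodType) (F : 'I_2 -> V) : \sum_i F i = F 0 + F 1.
Proof.
by rewrite !big_ord_recl big_ord0 addr0; congr (_ + F _); apply: val_inj.
Qed.

Lemma sum_ord4 (V : nmodType) (F : 'I_4 -> V) :
  \sum_i F i = F 0 + F 1 + F 2 + F 3.
Proof.
rewrite !big_ord_recl big_ord0 addr0 !addrA.
by congr (_ + F _ + F _ + F _); apply: val_inj.
Qed.

Lemma lift0_ord3 :
  (lift ord0 (0 : 'I_3) = 1) * (lift ord0 (1 : 'I_3) = 2) *
  (lift ord0 (2 : 'I_3) = 3).
Proof. by do 2?split; apply: val_inj. Qed.

Section UniversalTeleportation.
Variable R : realType.
Local Notation C := R[i].
Implicit Types (rho : 'M[C]_(2 * 2)) (psi : 'cV[C]_2).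

(** * Conjugation, adjoints, tensor products and Pauli matrices *)

Lemma conjE (x y : R) : (x +i* y)^* = x -i* y :> C. Proof. by []. Qed.

Lemma conj_imag : ('i%C)^* = - 'i%C :> C.
Proof. by rewrite conjE; congr Complex; rewrite oppr0. Qed.

Lemma sqr_imag : 'i%C * 'i%C = -1 :> C.
Proof. by rewrite -expr2 sqr_i. Qed.

Lemma inv_sqrt2 : ((Num.sqrt 2)^-1)%:C * ((Num.sqrt 2)^-1)%:C = (2^-1 : C).
Proof. by rewrite -rmorphM -invfM -expr2 sqr_sqrtr // fmorphV rmorph_nat. Qed.

Lemma adjmxM m n p (A : 'M[C]_(m, n)) (B : 'M[C]_(n, p)) :
  (A *m B)^t* = B^t* *m A^t*.
Proof. by rewrite trmx_mul map_mxM. Qed.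

Lemma adjmx_tens m n p q (A : 'M[C]_(m, n)) (B : 'M[C]_(p, q)) :
  (A *t B)^t* = A^t* *t B^t*.
Proof. by apply/matrixP => i j; rewrite !mxE rmorphM. Qed.

Lemma tensmx11 m n : (1%:M : 'M[C]_m) *t (1%:M : 'M[C]_n) = 1%:M.
Proof.
apply/matrixP => i j.
case: (mxtens_indexP i) => a b; case: (mxtens_indexP j) => c d.
by rewrite tensmxE !mxE (can_eq (@mxtens_indexK m n)) -natrM mulnb.
Qed.

Lemma mxtrace_tens m n (A : 'M[C]_m) (B : 'M[C]_n) :
  \tr (A *t B) = \tr A * \tr B.
Proof.
rewrite /mxtrace big_mxtens_index mulr_suml; apply: eq_bigr => a _.
by rewrite mulr_sumr; apply: eq_bigr => b _; rewrite tensmxE.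
Qed.

Lemma projE n (v : 'cV[C]_n) i j : Defs.proj v i j = v i 0 * (v j 0)^*.
Proof. by rewrite mxE big_ord1 !mxE. Qed.

Lemma pauli0E a b : pauli R 0 a b = (a == b)%:R.
Proof. by rewrite mxE. Qed.

Lemma pauli1E a b : pauli R 1 a b = (a != b)%:R.
Proof. by rewrite mxE. Qed.

Lemma pauli2E a b :
  pauli R 2 a b = if a == b then 0 else if a == 0 then - 'i%C else 'i%C.
Proof. by rewrite mxE. Qed.

Lemma pauli3E a b :
  pauli R 3 a b = if a != b then 0 else if a == 0 then 1 else -1.
Proof. by rewrite mxE. Qed.

Definition pauliE := (pauli0E, pauli1E, pauli2E, pauli3E).

Lemma pauli_herm k : (pauli R k)^t* = pauli R k.
Proof.
apply/matrixP => i j; rewrite mxE mxE.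
elim/forall_ord4: k; elim/forall_ord2: i; elim/forall_ord2: j;
  rewrite !pauliE ?ord2E /= ?rmorphN ?rmorph0 ?rmorph1 /= ?conj_imag ?opprK //.
Qed.

Lemma pauli_sqr k : pauli R k *m pauli R k = 1%:M.
Proof.
apply/matrixP => i j; rewrite !mxE sum_ord2.
elim/forall_ord4: k; elim/forall_ord2: i; elim/forall_ord2: j;
  rewrite !pauliE ?ord2E /= ?mulNr ?mulrN ?sqr_imag; ring.
Qed.

(** The [A]s stay abstract because [mxE] would otherwise open the Pauli matrices too early. *)
Lemma pauli_combE (x y z t : C) (A1 A2 A3 : 'M[C]_2) a b c d :
  (x%:M - y *: (A1 *t A1) - z *: (A2 *t A2) - t *: (A3 *t A3))
    (mxtens_index (a, b)) (mxtens_index (c, d)) =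
  x *+ ((a == c) && (b == d)) - y * (A1 a c * A1 b d) -
  z * (A2 a c * A2 b d) - t * (A3 a c * A3 b d).
Proof. by rewrite !mxE (can_eq (@mxtens_indexK 2 2)) !mxtens_indexK. Qed.

(** * Teleportation fidelity as a function of the Bloch vector *)

Lemma singletE a b :
  singlet R (mxtens_index (a, b)) 0 =
  ((Num.sqrt 2)^-1)%:C *
  (((a == 0) && (b == 1))%:R - ((a == 1) && (b == 0))%:R).
Proof.
by rewrite !mxE !(can_eq (@mxtens_indexK 2 2)) !xpair_eqE !eqxx !andbT.
Qed.

Lemma bellE k a b :
  bell R k (mxtens_index (a, b)) 0 =
  ((Num.sqrt 2)^-1)%:C * (if b == 0 then - pauli R k a 1 else pauli R k a 0).
Proof.
rewrite mxE big_mxtens_index !sum_ord2 !tensmxE !singletE.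
rewrite [1%:M b 0]mxE [1%:M b 1]mxE.
by elim/forall_ord2: b; rewrite !ord2E /=; ring.
Qed.

(* The map |v> |-> |psi>|v>. *)
Definition prepend_ket psi : 'M[C]_(2 * 2 * 2, 2 * 2) :=
  \matrix_(i, j)
    (psi (mxtens_unindex (cast_ord (esym (mulnA 2 2 2)) i)).1 0 *+
     ((mxtens_unindex (cast_ord (esym (mulnA 2 2 2)) i)).2 == j)).

(** This makes the joint state a conjugation of [rho], so that the whole protocol becomes linear
    algebra on [rho]. *)
Lemma prepend_ketE psi rho :
  castmx (mulnA 2 2 2, mulnA 2 2 2) (Defs.proj psi *t rho) =
  prepend_ket psi *m rho *m (prepend_ket psi)^t*.
Proof.
apply/matrixP => i j; rewrite castmxE !mxE !big_ord1 !mxE.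
set i' := cast_ord _ i; set j' := cast_ord _ j.
rewrite (bigD1 (mxtens_unindex j').2) //= big1 ?addr0 => [|k kj]; last first.
  by rewrite !mxE eq_sym (negPf kj) mulr0n rmorph0 mulr0.
rewrite !mxE (bigD1 (mxtens_unindex i').2) //= big1 ?addr0 => [|k ki];
  last first.
  by rewrite !mxE eq_sym (negPf ki) mulr0n mul0r.
by rewrite !mxE !eqxx !mulr1n mulrAC.
Qed.

(* Outcome [k] contributes <w|rho|w> to the fidelity, w = [tele_vec psi k]. *)
Definition tele_vec psi (k : 'I_4) : 'cV[C]_(2 * 2) :=
  (prepend_ket psi)^t* *m
  (((bell R k)^t* *t (1%:M : 'M[C]_2))^t* *m ((pauli R k)^t* *m psi)).

(** Each branch has the form B rho B^*, so cyclicity of the trace moves every factor onto [psi]. *)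
Lemma tele_branchE rho psi k :
  (psi^t* *m tele_branch rho psi k *m psi) 0 0 =
  \tr (rho *m Defs.proj (tele_vec psi k)).
Proof.
rewrite /tele_branch prepend_ketE.
rewrite /Defs.proj -[LHS]trace_mx11 [in RHS]mulmxA [RHS]mxtrace_mulC.
congr mxtrace.
by rewrite /tele_vec !adjmxM !trmxCK !mulmxA.
Qed.

(** The vector is a product: Alice's factor contracts the Bell vector with the conjugate of [psi],
    and Bob's is the corrected input. *)
Lemma tele_vecE psi k b c :
  tele_vec psi k (mxtens_index (b, c)) 0 =
  (\sum_a bell R k (mxtens_index (a, b)) 0 * (psi a 0)^*) *
  ((pauli R k)^t* *m psi) c 0.
Proof.
set v := _ *m psi.
rewrite mxE big_mxtens_index mulr_suml.
rewrite big_mxtens_index; apply: eq_bigr => a _.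
(* [prepend_ket] copies the shared pair unchanged, so only the summands with indices [b] and [c]
   survive. *)
rewrite (bigD1 b) //= [X in _ + X]big1 ?addr0 => [|b' b'b]; last first.
  apply: big1 => c' _; rewrite !mxE mxtens_indexA mxtens_indexK /=.
  rewrite (can_eq (@mxtens_indexK 2 2)) xpair_eqE.
  by rewrite (negPf b'b) mulr0n rmorph0 mul0r.
rewrite (bigD1 c) //= [X in _ + X]big1 ?addr0 => [|c' c'c]; last first.
  rewrite !mxE mxtens_indexA mxtens_indexK /=.
  rewrite (can_eq (@mxtens_indexK 2 2)) xpair_eqE.
  by rewrite (negPf c'c) andbF mulr0n rmorph0 mul0r.
rewrite 2!mxE mxE mxtens_indexA mxtens_indexK /= eqxx mulr1n.
rewrite mulrC -mulrA [RHS]mulrCA mulrC; congr (_ * _).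
rewrite mxE (@big_mxtens_index _ 1 2) big_ord1 adjmx_tens trmxCK.
have vE d : v (@mxtens_index 1 2 (0, d)) 0 = v d 0.
  by congr (v _ _); apply: val_inj.
rewrite (bigD1 c) //= big1 ?addr0 => [|d dc]; last first.
  by rewrite tensmxE !mxE (negPf dc) rmorph0 mulr0 mul0r.
rewrite tensmxE.
have -> : (1%:M : 'M[C]_2)^t* c c = 1 by rewrite !mxE eqxx rmorph1.
by rewrite mulr1; congr (_ * _); exact: vE.
Qed.

(* The subtracted squares are those of the components of the Bloch vector of
   [psi = (a, c + id)]. *)
Lemma tele_proj (a c d : R) psi : psi 0 0 = a%:C -> psi 1 0 = c +i* d ->
  \sum_k Defs.proj (tele_vec psi k) =
  2^-1 *: (((a ^+ 2 + c ^+ 2 + d ^+ 2) ^+ 2)%:C%:M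
   - ((2 * a * c) ^+ 2)%:C *: (pauli R 1 *t pauli R 1)
   - ((2 * a * d) ^+ 2)%:C *: (pauli R 2 *t pauli R 2)
   - ((a ^+ 2 - c ^+ 2 - d ^+ 2) ^+ 2)%:C *: (pauli R 3 *t pauli R 3)).
Proof.
move=> psi0 psi1.
(* [b] and [g] are Alice's and Bob's factors of [tele_vec], up to normalisation. *)
pose b (k : 'I_4) (i : 'I_2) : C :=
  \sum_j (if i == 0 then - pauli R k j 1 else pauli R k j 0) * (psi j 0)^*.
pose g (k : 'I_4) (i : 'I_2) : C := ((pauli R k)^t* *m psi) i 0.
have vE k i j : tele_vec psi k (mxtens_index (i, j)) 0 =
    ((Num.sqrt 2)^-1)%:C * (b k i * g k j).
  rewrite tele_vecE mulrA mulr_sumr; congr (_ * _).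
  by apply: eq_bigr => l _; rewrite bellE mulrA.
apply/matrixP => i j.
case: (mxtens_indexP i) => i1 i2; case: (mxtens_indexP j) => j1 j2.
rewrite summxE
  (eq_bigr (fun k => 2^-1 * ((b k i1 * g k i2) * (b k j1 * g k j2)^*)));
  last first.
  move=> k _; rewrite projE !vE -inv_sqrt2 rmorphM /= mulrACA.
  congr (_ * _ * _).
  exact: conjc_real.
rewrite -mulr_sumr [RHS]mxE; congr (_ * _).
rewrite pauli_combE sum_ord4.
have gE k l : g k l = (pauli R k 0 l)^* * a%:C + (pauli R k 1 l)^* * (c +i* d).
  by rewrite /g mxE sum_ord2 !mxE psi0 psi1.
have bE k l : b k l =
    (if l == 0 then - pauli R k 0 1 else pauli R k 0 0) * (a +i* 0) +
    (if l == 0 then - pauli R k 1 1 else pauli R k 1 0) * (c -i* d).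
  by rewrite /b sum_ord2 psi0 psi1 -conjE; congr (_ * _ + _); exact: conjc_real.
rewrite !gE !bE.
clear vE gE bE; clear b g.
(* With every scalar written as a pair of reals, each of the sixteen entries becomes two real
   polynomial identities. *)
have iE : 'i%C = 0 +i* 1 :> C by [].
elim/forall_ord2: i1; elim/forall_ord2: i2;
  elim/forall_ord2: j1; elim/forall_ord2: j2;
  rewrite !pauliE ?ord2E /=;
  rewrite ?(conj_imag, rmorphN, rmorph1, rmorph0, oppr0, opprK) -?complexr0 ?iE;
  rewrite ?(mul0r, mulr0, mul1r, mulr1, add0r, addr0, mulN1r, mulr0n, mulr1n);
  rewrite ?(conjE, rmorphM, rmorphN) /=;
  apply/eqP; rewrite eq_complex; apply/andP; split; apply/eqP; rewrite /=; ring.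
Qed.

Lemma mxtrace_comb n (rho A1 A2 A3 : 'M[C]_n) (x y t1 t2 t3 : C) :
  \tr (rho *m (x *: (y%:M - t1 *: A1 - t2 *: A2 - t3 *: A3))) =
  x * (y * \tr rho - t1 * \tr (rho *m A1) - t2 * \tr (rho *m A2) -
       t3 * \tr (rho *m A3)).
Proof.
rewrite -scalemxAr mxtraceZ !mulmxBr mul_mx_scalar -!scalemxAr.
by rewrite !raddfB /= !mxtraceZ.
Qed.

Lemma Re_half_realM (x : R) (z : C) :
  complex.Re (x%:C * (2^-1 * z)) = x / 2 * complex.Re z.
Proof.
have -> : (2^-1 : C) = (2^-1)%:C by rewrite fmorphV rmorph_nat.
by rewrite mulrA -rmorphM /=; case: z => u v /=; rewrite mul0r subr0.
Qed.

Lemma Re_comb (y t1 t2 t3 : R) (z z1 z2 z3 : C) :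
  complex.Re (2^-1 * (y%:C * z - t1%:C * z1 - t2%:C * z2 - t3%:C * z3)) =
  2^-1 * (y * complex.Re z - t1 * complex.Re z1 - t2 * complex.Re z2 -
          t3 * complex.Re z3).
Proof.
rewrite -[X in complex.Re X]mul1r Re_half_realM mul1r.
by case: z z1 z2 z3 => [? ?] [? ?] [? ?] [? ?] /=; rewrite !mul0r !subr0.
Qed.

(** The first amplitude is real, as in [bloch_ket]; [psi] need not be a unit vector, so the trace
    carries the fourth power of its norm. *)
Lemma tele_fidelityE rho (a c d : R) psi :
  psi 0 0 = a%:C -> psi 1 0 = c +i* d ->
  tele_fidelity rho psi =
  2^-1 * ((a ^+ 2 + c ^+ 2 + d ^+ 2) ^+ 2 * complex.Re (\tr rho)
   - (2 * a * c) ^+ 2 * correlation_mx rho 0 0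
   - (2 * a * d) ^+ 2 * correlation_mx rho 1 1
   - (a ^+ 2 - c ^+ 2 - d ^+ 2) ^+ 2 * correlation_mx rho 2 2).
Proof.
move=> psi0 psi1.
have -> : tele_fidelity rho psi =
    complex.Re (\tr (rho *m \sum_k Defs.proj (tele_vec psi k))).
  rewrite /tele_fidelity /tele_output; congr complex.Re.
  rewrite mulmx_sumr mulmx_suml mulmx_sumr summxE raddf_sum /=.
  by apply: eq_bigr => k _; exact: tele_branchE.
rewrite (tele_proj psi0 psi1) mxtrace_comb.
have corrE i j : correlation_mx rho i j =
    complex.Re (\tr (rho *m (pauli R (lift ord0 i) *t pauli R (lift ord0 j)))).
  by rewrite mxE.
by rewrite Re_comb !corrE !lift0_ord3.
Qed.

Lemma bloch_fidelity rho theta phi :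
  tele_fidelity rho (bloch_ket theta phi) =
  2^-1 * (complex.Re (\tr rho)
   - (sin theta * cos phi) ^+ 2 * correlation_mx rho 0 0
   - (sin theta * sin phi) ^+ 2 * correlation_mx rho 1 1
   - cos theta ^+ 2 * correlation_mx rho 2 2).
Proof.
rewrite (@tele_fidelityE rho (cos (theta / 2)) (cos phi * sin (theta / 2))
  (sin phi * sin (theta / 2))).
(* Double-angle formulas turn the amplitudes into the components of the Bloch vector. *)
- have tE : theta = theta / 2 + theta / 2 by lra.
  have sE : sin theta = 2 * cos (theta / 2) * sin (theta / 2).
    by rewrite {1}tE sinD; ring.
  have cE : cos theta = cos (theta / 2) ^+ 2 - sin (theta / 2) ^+ 2.
    by rewrite {1}tE cosD; ring.
  rewrite sE cE.
  set s := sin _; set c := cos _; set u := cos _; set v := sin _.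
  have nE : (u * s) ^+ 2 + (v * s) ^+ 2 = s ^+ 2.
    by rewrite !exprMn -mulrDl cos2Dsin2 mul1r.
  have -> : c ^+ 2 + (u * s) ^+ 2 + (v * s) ^+ 2 = 1.
    by rewrite -addrA nE cos2Dsin2.
  have -> : c ^+ 2 - (u * s) ^+ 2 - (v * s) ^+ 2 = c ^+ 2 - s ^+ 2.
    by rewrite -nE; ring.
  by ring.
- by rewrite mxE.
- by rewrite mxE /=; simpc.
Qed.

(** * Integration over the Bloch sphere *)

Lemma Rintegral_FTC (f F : R -> R) (a b : R) : a < b ->
  (forall x, is_derive x (1 : R) F (f x)) -> (forall x, derivable f x 1) ->
  \int[@lebesgue_measure R]_(x in `[a, b]) f x = F b - F a.
Proof.
move=> ab dF df; rewrite /Rintegral (@continuous_FTC2 R f F) //=.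
- apply: continuous_subspaceT => x.
  by apply: differentiable_continuous; apply/derivable1_diffP; exact: df.
- have cF : continuous F.
    move=> x; apply: differentiable_continuous.
    by apply/derivable1_diffP; case: (dF x).
  split.
  + by move=> x _; case: (dF x).
  + by apply: cvg_at_right_filter; exact: cF.
  + by apply: cvg_at_left_filter; exact: cF.
- by move=> x _; rewrite derive1E; case: (dF x).
Qed.

(** Each squared coordinate has mean 1/3 on the unit sphere. Both iterated integrals are computed
    from explicit antiderivatives. *)
Lemma uniform_mean_quadratic (g : 'cV[R[i]]_2 -> R) (x b1 b2 b3 : R) :
  (forall theta phi, g (bloch_ket theta phi) =
     x + b1 * (sin theta * cos phi) ^+ 2 + b2 * (sin theta * sin phi) ^+ 2
       + b3 * cos theta ^+ 2) ->
  uniform_mean g = x + (b1 + b2 + b3) / 3.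
Proof.
move=> gE; rewrite /uniform_mean.
have pi_gt0 := pi_gt0 R.
have inner theta : \int[@lebesgue_measure R]_(phi in `[0, 2 * pi])
      (g (bloch_ket theta phi) * sin theta) =
   (2 * pi * x + pi * (b1 + b2) +
    (2 * pi * b3 - pi * (b1 + b2)) * cos theta ^+ 2) * sin theta.
  pose s := sin theta; pose c := cos theta.
  (* Antiderivative in [phi]: cos^2 and sin^2 integrate to (phi + sin cos)/2 and (phi - sin
     cos)/2. *)
  pose F phi : R := (x * phi + b1 * s ^+ 2 / 2 * (phi + sin phi * cos phi)
    + b2 * s ^+ 2 / 2 * (phi - sin phi * cos phi) + b3 * c ^+ 2 * phi) * s.
  under eq_Rintegral do rewrite gE -/s -/c.
  pose f phi : R :=
    (x + b1 * (s * cos phi) ^+ 2 + b2 * (s * sin phi) ^+ 2 + b3 * c ^+ 2) * s.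
  have dF (phi : R) : is_derive phi 1 F (f phi).
    rewrite /F; apply: is_derive_eq; rewrite /GRing.scale /= /f.
    have cs : cos phi * cos phi = 1 - sin phi * sin phi.
      by rewrite -!expr2 cos2sin2.
    rewrite cs [(s * cos phi) ^+ 2]exprMn [cos phi ^+ 2]expr2 cs; by field.
  rewrite (Rintegral_FTC _ dF) /=; last 2 first.
  - by rewrite mulr_gt0.
  - by move=> phi; exact: ex_derive.
  rewrite /F sin0 (_ : sin (2 * pi) = 0); last first.
    by rewrite mulrC mulr_natr -{1}[_ *+ 2]add0r sinD2pi sin0.
  (* Eliminating sin^2 leaves a polynomial in cos theta times sin theta, which [G] below
     integrates. *)
  have -> : b1 * s ^+ 2 = b1 - b1 * c ^+ 2 by rewrite /s /c sin2cos2; ring.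
  have -> : b2 * s ^+ 2 = b2 - b2 * c ^+ 2 by rewrite /s /c sin2cos2; ring.
  by rewrite -/s -/c; field.
under eq_Rintegral do rewrite inner.
pose G theta : R := - (2 * pi * x + pi * (b1 + b2)) * cos theta -
    (2 * pi * b3 - pi * (b1 + b2)) / 3 * cos theta ^+ 3.
pose h theta : R := (2 * pi * x + pi * (b1 + b2) +
    (2 * pi * b3 - pi * (b1 + b2)) * cos theta ^+ 2) * sin theta.
have dG (theta : R) : is_derive theta 1 G (h theta).
  rewrite /G; apply: is_derive_eq; rewrite /GRing.scale /= /h.
  by field.
rewrite (Rintegral_FTC _ dG) //.
  rewrite /G cospi cos0; move: (pi : R) pi_gt0 => p p_gt0; field.
  by rewrite gt_eqF.
Qed.

(** * Positive semidefinite matrices and Kraus maps *)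

Lemma hermsymmxP n (A : 'M[C]_n) : reflect (A^t* = A) (A \is hermsymmx).
Proof.
rewrite is_hermitianmxE expr0 scale1r.
by apply: (iffP eqP) => [{2}->|->].
Qed.

Lemma psdmx_conj m n (B : 'M[C]_(m, n)) (A : 'M[C]_n) :
  psdmx A -> psdmx (B *m A *m B^t*).
Proof.
move=> [/hermsymmxP hA posA]; split.
  by apply/hermsymmxP; rewrite !adjmxM trmxCK hA mulmxA.
by move=> v; have := posA (B^t* *m v); rewrite adjmxM trmxCK !mulmxA.
Qed.

Lemma psdmx_sum_scale n (I : finType) (w : I -> R) (A : I -> 'M[C]_n) :
  (forall k, 0 <= w k) -> (forall k, psdmx (A k)) ->
  psdmx (\sum_k (w k)%:C *: A k).
Proof.
move=> w0 psdA; split.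
  apply/hermsymmxP/matrixP => i j; rewrite !mxE !summxE rmorph_sum.
  apply: eq_bigr => k _; have [/hermsymmxP hA _] := psdA k.
  rewrite -[in RHS]hA !mxE rmorphM; congr (_ * _); exact: conjc_real.
move=> v; rewrite mulmx_sumr mulmx_suml summxE; apply: sumr_ge0 => k _.
rewrite -scalemxAr -scalemxAl mxE mulr_ge0 ?ler0c //.
by have [_] := psdA k; apply.
Qed.

Lemma idtensE n (L : 'M[C]_2 -> 'M[C]_2) (X : 'M[C]_(n * 2)) a b c d :
  idtens L X (mxtens_index (a, b)) (mxtens_index (c, d)) =
  L (\matrix_(k, l) X (mxtens_index (a, k)) (mxtens_index (c, l))) b d.
Proof.
rewrite /idtens summxE (bigD1 a) //= [X in _ + X]big1 ?addr0 => [|i ia];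
  last first.
  rewrite summxE big1 // => j _.
  by rewrite tensmxE mxE eq_sym (negPf ia) mul0r.
rewrite summxE (bigD1 c) //= [X in _ + X]big1 ?addr0 => [|j jc]; last first.
  by rewrite tensmxE mxE [c == j]eq_sym (negPf jc) andbF mul0r.
by rewrite tensmxE mxE !eqxx mul1r.
Qed.

Lemma tens1_conjE n (K : 'M[C]_2) (X : 'M[C]_(n * 2)) a b c d :
  ((1%:M *t K) *m X *m (1%:M *t K)^t*)
     (mxtens_index (a, b)) (mxtens_index (c, d)) =
  (K *m (\matrix_(k, l) X (mxtens_index (a, k)) (mxtens_index (c, l)))
     *m K^t*) b d.
Proof.
have tens1E m (B : 'M[C]_2) (Y : 'M[C]_(n * 2, m)) e i j :
    ((1%:M *t B) *m Y) (mxtens_index (e, i)) j =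
    \sum_k B i k * Y (mxtens_index (e, k)) j.
  rewrite mxE big_mxtens_index (bigD1 e) //= [X in _ + X]big1 ?addr0 => [|f fe].
    by apply: eq_bigr => k _; rewrite tensmxE mxE eqxx mul1r.
  rewrite big1 // => k _.
  by rewrite tensmxE mxE eq_sym (negPf fe) mul0r mul0r.
have tens1rE m (B : 'M[C]_2) (Y : 'M[C]_(m, n * 2)) e i j :
    (Y *m (1%:M *t B)) j (mxtens_index (e, i)) =
    \sum_k Y j (mxtens_index (e, k)) * B k i.
  rewrite mxE big_mxtens_index (bigD1 e) //= [X in _ + X]big1 ?addr0 => [|f fe].
    by apply: eq_bigr => k _; rewrite tensmxE mxE eqxx mul1r.
  rewrite big1 // => k _.
  by rewrite tensmxE mxE (negPf fe) mul0r mulr0.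
rewrite adjmx_tens trmx1 map_mx1 tens1rE mxE; apply: eq_bigr => l _.
rewrite tens1E [in RHS]mxE; congr (_ * _).
by apply: eq_bigr => k _; rewrite mxE.
Qed.

(** The extended map is again of Kraus form, with operators 1 (x) K_k. For nonnegative weights,
    complete positivity thus reduces to [psdmx_conj] and [psdmx_sum_scale]. *)
Lemma kraus_idtens n (I : finType) (w : I -> C) (K : I -> 'M[C]_2)
    (X : 'M[C]_(n * 2)) :
  idtens (fun X => \sum_k w k *: (K k *m X *m (K k)^t*)) X =
  \sum_k w k *: ((1%:M *t K k) *m X *m (1%:M *t K k)^t*).
Proof.
apply/matrixP => i j.
case: (mxtens_indexP i) => a b; case: (mxtens_indexP j) => c d.
rewrite idtensE !summxE; apply: eq_bigr => k _.
by rewrite [LHS]mxE [RHS]mxE tens1_conjE.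
Qed.

(** * The channel family and its Choi states *)

Definition depol_weight (p : R) (k : 'I_4) : R :=
  if k == 2 then (1 + 3 * p) / 4 else (1 - p) / 4.

(** This is the depolarizing channel X -> p X + (1 - p) tr(X)/2 followed by conjugation by
    sigma_2. *)
Definition depol (p : R) (X : 'M[C]_2) : 'M[C]_2 :=
  \sum_k (depol_weight p k)%:C *: (pauli R k *m X *m (pauli R k)^t*).

Fact depol_is_linear p : linear (depol p).
Proof.
move=> x A B; rewrite /depol scaler_sumr -big_split; apply: eq_bigr => k _ /=.
rewrite mulmxDr mulmxDl scalerDr -scalemxAr -scalemxAl !scalerA.
by rewrite [x * _]mulrC.
Qed.

HB.instance Definition _ p :=
  GRing.isLinear.Build C 'M[C]_2 'M[C]_2 *:%R (depol p) (depol_is_linear p).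

Lemma depol_channel p : 0 <= p <= 1 -> qubit_channel (depol p).
Proof.
move=> /andP[p0 p1]; split.
  move=> n X psdX; rewrite kraus_idtens; apply: psdmx_sum_scale => k.
    by rewrite /depol_weight; case: ifP => _; lra.
  exact: psdmx_conj.
move=> X; rewrite /depol raddf_sum /=.
have trE k : \tr (pauli R k *m X *m (pauli R k)^t*) = \tr X.
  by rewrite mxtrace_mulC mulmxA pauli_herm pauli_sqr mul1mx.
under eq_bigr do rewrite mxtraceZ trE.
have sumw : \sum_k depol_weight p k = 1.
  by rewrite sum_ord4 /depol_weight /=; lra.
by rewrite -mulr_suml -(rmorph_sum (real_complex R)) /= sumw mul1r.
Qed.

Lemma proj_singletE a b c d :
  Defs.proj (singlet R) (mxtens_index (a, b)) (mxtens_index (c, d)) =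
  2^-1 * ((((a == 0) && (b == 1))%:R - ((a == 1) && (b == 0))%:R) *
          (((c == 0) && (d == 1))%:R - ((c == 1) && (d == 0))%:R)).
Proof.
rewrite projE !singletE -inv_sqrt2 rmorphM rmorphB !rmorph_nat [LHS]mulrACA.
by congr (_ * _ * _); exact: conjc_real.
Qed.

Lemma proj_Phi1E a b c d :
  Defs.proj (Phi1 R) (mxtens_index (a, b)) (mxtens_index (c, d)) =
  2^-1 * ((a == b) && (c == d))%:R.
Proof.
have PhiE i j :
    Phi1 R (mxtens_index (i, j)) 0 = ((Num.sqrt 2)^-1)%:C * (i == j)%:R.
  rewrite !mxE !(can_eq (@mxtens_indexK 2 2)) !xpair_eqE !eqxx !andbT.
  congr (_ * _).
  by elim/forall_ord2: i; elim/forall_ord2: j; rewrite !ord2E /= ?addr0 ?add0r.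
rewrite projE !PhiE -inv_sqrt2 rmorphM [LHS]mulrACA rmorph_nat -natrM mulnb.
congr (_ * _ * _); exact: conjc_real.
Qed.

Lemma choi_depol p :
  choi (depol p) = p%:C *: Defs.proj (singlet R) + ((1 - p) / 4)%:C%:M.
Proof.
apply/matrixP => i j.
case: (mxtens_indexP i) => a b; case: (mxtens_indexP j) => c d.
rewrite /choi idtensE.
set X := (\matrix_(k, l) _).
(* The blocks of the Bell projector are half the matrix units, whose Pauli conjugates are products
   of two entries. *)
have XE : X = 2^-1 *: delta_mx a c.
  apply/matrixP => k l.
  by rewrite mxE proj_Phi1E !mxE [a == k]eq_sym [c == l]eq_sym.
have kE k : (pauli R k *m X *m (pauli R k)^t*) b d =
    2^-1 * (pauli R k b a * pauli R k c d).
  rewrite XE -scalemxAr -scalemxAl [LHS]mxE pauli_herm; congr (_ * _).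
  rewrite mxE (bigD1 c) //= [X in _ + X]big1 => [|l lc]; last first.
    rewrite mxE big1 ?mul0r // => m _.
    by rewrite [delta_mx _ _ _ _]mxE (negPf lc) andbF mulr0.
  rewrite addr0 mxE (bigD1 a) //= [X in _ + X]big1 => [|m ma]; last first.
    by rewrite [delta_mx _ _ _ _]mxE (negPf ma) mulr0.
  by rewrite addr0 [delta_mx _ _ _ _]mxE !eqxx mulr1.
rewrite /depol summxE.
under eq_bigr do rewrite mxE kE.
have affE (x y : C) (A : 'M[C]_(2 * 2)) k l :
    (x *: A + y%:M) k l = x * A k l + y *+ (k == l) by rewrite !mxE.
rewrite affE proj_singletE (can_eq (@mxtens_indexK 2 2)) xpair_eqE.
rewrite sum_ord4 /depol_weight /= !rmorphM !rmorphD !rmorphN /=.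
rewrite !fmorphV /= !rmorph_nat.
clear X XE kE.
elim/forall_ord2: a; elim/forall_ord2: b;
  elim/forall_ord2: c; elim/forall_ord2: d;
  rewrite !pauliE ?ord2E /= ?mulNr ?mulrN ?sqr_imag; by field.
Qed.

(** * Mean and deviation of the fidelity from the correlation matrix *)

Lemma mean_fidelityE rho :
  mean_fidelity rho = (complex.Re (\tr rho) - \tr (correlation_mx rho) / 3) / 2.
Proof.
rewrite /mean_fidelity (@uniform_mean_quadratic _ (complex.Re (\tr rho) / 2)
  (- correlation_mx rho 0 0 / 2) (- correlation_mx rho 1 1 / 2)
  (- correlation_mx rho 2 2 / 2)); last first.
  by move=> theta phi; rewrite bloch_fidelity; field.
have -> : \tr (correlation_mx rho) =
    correlation_mx rho 0 0 + correlation_mx rho 1 1 + correlation_mx rho 2 2.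
  rewrite /mxtrace !big_ord_recl big_ord0 addr0 addrA.
  by congr (_ + correlation_mx rho _ _ + correlation_mx rho _ _);
    apply: val_inj.
by field.
Qed.

Lemma std_fidelity0 rho (x : R) :
  correlation_mx rho = x%:M -> std_fidelity rho = 0.
Proof.
move=> rhoE; rewrite /std_fidelity (@uniform_mean_quadratic _ 0 0 0 0).
  by rewrite !addr0 mul0r addr0 sqrtr0.
move=> theta phi; rewrite !mul0r !addr0.
(* The squared deviation vanishes pointwise: for scalar T the fidelity involves only the squared
   length of the Bloch vector, which is 1. *)
apply/eqP; rewrite sqrf_eq0 subr_eq0; apply/eqP.
rewrite mean_fidelityE bloch_fidelity rhoE mxtrace_scalar.
rewrite !mxE !eqxx !mulr1n -[x *+ 3]mulr_natr.
have := cos2Dsin2 theta; have := cos2Dsin2 phi => cs1 cs2.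
have -> : (sin theta * cos phi) ^+ 2 =
    sin theta ^+ 2 - (sin theta * sin phi) ^+ 2.
  rewrite !exprMn -(addKr (sin phi ^+ 2) (cos phi ^+ 2)).
  by rewrite [_ + cos phi ^+ 2]addrC cs1; ring.
have -> : cos theta ^+ 2 = 1 - sin theta ^+ 2 by rewrite -cs2; ring.
by field.
Qed.

(** * Trace, correlation matrix and rank of the Werner states *)

(** The right-hand side is the polarised determinant: it equals det A when A = B. *)
Lemma singlet_trace (A B : 'M[C]_2) :
  \tr (Defs.proj (singlet R) *m (A *t B)) =
  2^-1 * (A 0 0 * B 1 1 + A 1 1 * B 0 0 - A 0 1 * B 1 0 - A 1 0 * B 0 1).
Proof.
have tE (X Y : 'M[C]_(2 * 2)) : \tr (X *m Y) =
    \sum_a \sum_b \sum_c \sum_d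
    X (mxtens_index (a, b)) (mxtens_index (c, d)) *
    Y (mxtens_index (c, d)) (mxtens_index (a, b)).
  rewrite /mxtrace big_mxtens_index.
  apply: eq_bigr => a _; apply: eq_bigr => b _.
  by rewrite mxE big_mxtens_index.
rewrite tE !sum_ord2 !proj_singletE !ord2E /= !tensmxE; by field.
Qed.

Lemma mxtrace_singlet : \tr (Defs.proj (singlet R)) = 1.
Proof.
rewrite -[Defs.proj _]mulmx1 -tensmx11.
by rewrite singlet_trace !mxE !ord2E /=; field.
Qed.

Lemma mxtrace_choi_depol p : \tr (choi (depol p)) = 1 :> C.
Proof.
rewrite choi_depol mxtraceD mxtraceZ mxtrace_scalar mxtrace_singlet.
rewrite mulr1 -rmorphMn -rmorphD /= -[RHS](rmorph1 (real_complex R)).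
by rewrite -mulr_natr; congr (_%:C); field.
Qed.

Lemma correlation_choi_depol p : correlation_mx (choi (depol p)) = (- p)%:M.
Proof.
(* Tracelessness removes the contribution of the maximally mixed part. *)
have tr0 (i : 'I_3) : \tr (pauli R (lift ord0 i)) = 0.
  rewrite /mxtrace sum_ord2 !mxE /=.
  by case: i => [[|[|[|//]]] ?] /=; rewrite ?addr0 // addrN.
apply/matrixP => i j; rewrite mxE choi_depol mulmxDl mxtraceD.
rewrite -scalemxAl mxtraceZ.
rewrite mul_scalar_mx mxtraceZ mxtrace_tens tr0 mul0r mulr0 addr0 singlet_trace.
rewrite [RHS]mxE.
rewrite Re_half_realM; elim/forall_ord3: i; elim/forall_ord3: j;
  rewrite ?lift0_ord3 !pauliE ?ord2E /=; simpc; by field.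
Qed.

Lemma rank_choi_depol p : 0 <= p < 1 -> \rank (choi (depol p)) = 4%N.
Proof.
move=> /andP[p0 p1]; rewrite choi_depol.
set P := Defs.proj _; set a := (1 - p) / 4.
(* The eigenvalues are [a + p] on the singlet and [a] on its orthogonal complement. *)
have a0 : a != 0 by rewrite /a; lra.
have b0 : a + p != 0 by rewrite /a; lra.
clearbody a.
have PP : P *m P = P.
  have ss : (singlet R)^t* *m singlet R = 1%:M.
    by rewrite [LHS]mx11_scalar -trace_mx11 mxtrace_mulC mxtrace_singlet.
  by rewrite /P /Defs.proj mulmxA -[_ *m _ *m singlet R]mulmxA ss mulmx1.
apply: mxrank_unit.
(* The right factor is the spectral inverse: 1/a on the complement, and 1/a - p/(a(a+p)) = 1/(a+p)
   on the singlet. *)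
have : (p%:C *: P + a%:C%:M) *m (a^-1%:C%:M - (p / a / (a + p))%:C *: P) = 1%:M.
  have e : p / a - (p / a / (a + p) * p + p / a / (a + p) * a) = 0
    by field; rewrite a0 b0.
  rewrite mulmxBr !mulmxDl -!scalemxAr -!scalemxAl PP.
  rewrite !mul_scalar_mx !mul_mx_scalar.
  rewrite scale_scalar_mx !scalerA -!rmorphM /= mulfV // -scalerDl.
  rewrite -rmorphD addrAC.
  by rewrite -scalerBl -rmorphB /= e scale0r add0r.
by case/mulmx1_unit.
Qed.

(** * Boundedness of the fidelity over local unitaries *)

Lemma unitary_entry_le1 n (U : 'M[C]_n) i j : U \is unitarymx -> `|U i j| <= 1.
Proof.
(* The diagonal entry of U U^* = 1 says that row [i] has unit norm. *)
move=> /unitarymxP /matrixP /(_ i i); rewrite !mxE eqxx => U1.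
rewrite -(@expr_le1 _ 2) // -[leRHS]U1 (bigD1 j) //= mxE mxE -normCK lerDl.
by apply: sumr_ge0 => k _; rewrite !mxE -normCK exprn_ge0.
Qed.

Lemma mulmx_entry_le m n q (A : 'M[C]_(m, n)) (B : 'M[C]_(n, q)) a b :
  (forall i j, `|A i j| <= a) -> (forall i j, `|B i j| <= b) ->
  forall i j, `|(A *m B) i j| <= (a * b) *+ n.
Proof.
move=> leA leB i j; rewrite mxE (le_trans (ler_norm_sum _ _ _)) //.
rewrite -[X in _ *+ X]card_ord -sumr_const; apply: ler_sum => k _.
by rewrite normrM ler_pM.
Qed.

Lemma tensmx_entry_le1 m n (A : 'M[C]_m) (B : 'M[C]_n) :
  (forall i j, `|A i j| <= 1) -> (forall i j, `|B i j| <= 1) ->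
  forall i j, `|(A *t B) i j| <= 1.
Proof. by move=> leA leB i j; rewrite mxE normrM mulr_ile1. Qed.

Lemma adjmx_entry_le m n (A : 'M[C]_(m, n)) a :
  (forall i j, `|A i j| <= a) -> forall i j, `|A^t* i j| <= a.
Proof. by move=> leA i j; rewrite !mxE norm_conjC. Qed.

(* [sup] has a junk value on unbounded sets, hence the need for some bound. *)
Lemma correlation_bounded rho : exists M : R, forall U V : 'M[C]_2,
  U \is unitarymx -> V \is unitarymx ->
  forall k, `|correlation_mx (local_rotation U V rho) k k| <= M.
Proof.
pose r : C := \sum_i \sum_j `|rho i j|.
have le_r i j : `|rho i j| <= r.
  rewrite /r (bigD1 i) //= (bigD1 j) //= -addrA lerDl addr_ge0 ?sumr_ge0 //.
  by move=> k _; rewrite sumr_ge0.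
(* Three products of 4 x 4 matrices and one trace each cost a factor 4. *)
pose M : C := ((1 * r) *+ 4 * 1) *+ 4 * 1 *+ 4 *+ 4.
exists (complex.Re M) => U V uU uV k.
have leW : forall i j, `|(U *t V) i j| <= 1.
  by apply: tensmx_entry_le1 => i j; exact: unitary_entry_le1.
have leP : forall i j,
    `|(pauli R (lift ord0 k) *t pauli R (lift ord0 k)) i j| <= 1.
  have uP : pauli R (lift ord0 k) \is unitarymx.
    by apply/unitarymxP; rewrite pauli_herm pauli_sqr.
  by apply: tensmx_entry_le1 => i j; exact: unitary_entry_le1.
have le := mulmx_entry_le
  (mulmx_entry_le (mulmx_entry_le leW le_r) (adjmx_entry_le leW)) leP.
rewrite mxE /local_rotation.
set Z := _ *m _ *m _ *m _ in le *.
have : `|\tr Z| <= M.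
  rewrite /mxtrace (le_trans (ler_norm_sum _ _ _)) //.
  rewrite /M -[X in _ *+ X](card_ord (2 * 2)) -sumr_const.
  by apply: ler_sum => i _; exact: le.
move=> /(le_trans (normc_ge_Re _)).
by rewrite lecE => /andP[].
Qed.

Lemma unitarymx_tens (U V : 'M[C]_2) : U \is unitarymx -> V \is unitarymx ->
  (U *t V)^t* *m (U *t V) = 1%:M.
Proof.
rewrite -trmxC_unitary => /unitarymxP; rewrite trmxCK => uU.
rewrite -trmxC_unitary => /unitarymxP; rewrite trmxCK => uV.
rewrite adjmx_tens tensmx_mul uU uV.
exact: tensmx11.
Qed.

Lemma mxtrace_local_rotation U V rho : U \is unitarymx -> V \is unitarymx ->
  \tr (local_rotation U V rho) = \tr rho.
Proof.
move=> uU uV.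
by rewrite /local_rotation mxtrace_mulC mulmxA (unitarymx_tens uU uV) mul1mx.
Qed.

Lemma unitarymx1 n : (1%:M : 'M[C]_n) \is unitarymx.
Proof. by apply/unitarymxP; rewrite trmx1 map_mx1 mulmx1. Qed.

Lemma local_rotation1 rho : local_rotation 1%:M 1%:M rho = rho.
Proof.
by rewrite /local_rotation tensmx11 trmx1 map_mx1 mulmx1 mul1mx.
Qed.

(** The identity rotation is a competitor. The supremum is genuine because rotations preserve the
    trace and keep the diagonal of T bounded. *)
Lemma le_max_fidelity rho : mean_fidelity rho <= max_fidelity rho.
Proof.
apply: ub_le_sup; last first.
  by exists 1%:M, 1%:M; split; rewrite ?unitarymx1 ?local_rotation1.
have [M leM] := correlation_bounded rho.
exists ((complex.Re (\tr rho) + M) / 2) => _ [U [V [uU uV ->]]].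
rewrite mean_fidelityE (mxtrace_local_rotation _ uU uV).
have : - \tr (correlation_mx (local_rotation U V rho)) <= M *+ 3.
  rewrite /mxtrace -sumrN -[X in _ *+ X](card_ord 3) -sumr_const.
  apply: ler_sum => k _; rewrite (le_trans _ (leM _ _ uU uV k)) //.
  by rewrite -normrN ler_norm.
by lra.
Qed.

(** * Fidelity deviation and fidelity of the Choi states *)

Lemma fidelity_deviation_choi_depol p : 0 <= p ->
  fidelity_deviation (choi (depol p)) = 0.
Proof.
move=> p0; rewrite /fidelity_deviation /Defs.canonical_form.
set rho := choi _.
(* Existence of a canonical form is not established: failing one, [xget] returns [rho], whose
   correlation matrix is already scalar. *)
have [exC|nexC] := pselect (exists rhoC, is_canonical_form rho rhoC);
  last first.
  rewrite xgetPN => [|rhoC XrhoC]; last by apply: nexC; exists rhoC.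
  by apply: std_fidelity0; exact: correlation_choi_depol.
have [U [V [s [l [_ _ [s0 chi] signs TE]]]]] := xgetPex rho exC.
rewrite correlation_choi_depol in chi signs.
(* T^T T = p^2, so each s_k^2 is a root of (X - p^2)^3; both s_k and p are nonnegative. *)
have sE k : s k = p.
  have : (char_poly (((- p)%:M : 'M[R]_3)^T *m (- p)%:M)).[s k ^+ 2] = 0.
    by rewrite chi (bigD1 k) //= hornerM !hornerE subrr mul0r.
  rewrite tr_scalar_mx -scalar_mxM /char_poly /char_poly_mx map_scalar_mx /=.
  rewrite -raddfB /= det_scalar !hornerE => /eqP.
  rewrite expf_eq0 /= subr_eq0 mulrNN -expr2.
  by rewrite eqrXn2 // => /eqP.
(* The determinant is -p^3 <= 0, so all signs are -1 and any canonical form again has T = -p. *)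
move: signs; rewrite /canonical_signs det_scalar ifT => [lE|]; last first.
  by rewrite exprS mulNr oppr_le0 mulr_ge0 // sqrrN exprn_ge0.
apply: (@std_fidelity0 _ (- p)); rewrite TE.
apply/matrixP => i j; rewrite !mxE lE sE mulN1r.
by [].
Qed.

Lemma mean_fidelity_choi_depol p : mean_fidelity (choi (depol p)) = (1 + p) / 2.
Proof.
rewrite mean_fidelityE mxtrace_choi_depol correlation_choi_depol.
by rewrite mxtrace_scalar /= -mulr_natr; field.
Qed.

Lemma max_fidelity_choi_depol0 : max_fidelity (choi (depol (0 : R))) = 2^-1.
Proof.
rewrite /max_fidelity (_ : mkset _ = [set 2^-1]) ?sup1 //.
have rot U V : U \is unitarymx -> V \is unitarymx ->
    local_rotation U V (choi (depol 0)) = choi (depol (0 : R)).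
  move=> uU uV.
  rewrite choi_depol scale0r add0r /local_rotation mul_mx_scalar -scalemxAl.
  rewrite (mulmx1C (unitarymx_tens uU uV)) scalemx1 //.
have half : mean_fidelity (choi (depol (0 : R))) = 2^-1.
  by rewrite mean_fidelity_choi_depol addr0 mul1r.
apply/seteqP; split => [_ [U [V [uU uV ->]]]|_ ->] /=.
  by rewrite (rot _ _ uU uV).
by exists 1%:M, 1%:M; split; rewrite ?unitarymx1 ?local_rotation1.
Qed.

End UniversalTeleportation.

Theorem proposition4 (R : realType) :
  @U4 R !=set0 /\ @U4 R `<` @C4 R.
Proof.
have C4_depol (p : R) : 0 <= p < 1 ->
    C4 (depol p : {linear 'M[R[i]]_2 -> 'M[R[i]]_2}).
  move=> /andP[p0 p1]; split; last by apply: rank_choi_depol; rewrite p0.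
  by apply: depol_channel; rewrite p0 ltW.
split; last split.
(* Any p with 1/3 < p < 1 would serve, since the unrotated mean fidelity (1 + p)/2 must exceed
   2/3. *)
- exists (depol 2^-1); split; first by apply: C4_depol; lra.
  split; last by apply: fidelity_deviation_choi_depol; lra.
  apply: lt_le_trans (le_max_fidelity _).
  by rewrite mean_fidelity_choi_depol; lra.
- by move=> L [].
(* Strictness: at p = 0 the maximal fidelity 1/2 misses the threshold. *)
- move=> /(_ (depol 0)) []; first by apply: C4_depol; lra.
  by move=> _ [] /=; rewrite max_fidelity_choi_depol0; lra.
Qed.
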